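(* There is an absolute constant $C>0$ such that the following holds. Let $G=(V,E)$ be any connected $n$-node graph with diameter $D$ and minor density $\delta=\delta(G)$. Then for every partition of $V$ into parts $P_1,\dots,P_k$ such that each induced subgraph $G[P_i]$ is connected, there exists a shortcut $H_1,\dots,H_k$ for $P_1,\dots,P_k$ with dilation at most $C\,\delta D$ and congestion at most $C\,\delta D\log n$.
   Context: Minor: a graph $H=(V',E')$ is a minor of $G$ if $H$ can be obtained from $G$ by deleting vertices/edges and contracting edges. The minor density of $G$ is $\delta(G)=\max\{|E'|/|V'| : H=(V',E') \text{ is a minor of } G\}$. Given pairwise disjoint vertex sets $P_1,\dots,P_k$ of $G$, each inducing a connected subgraph, a shortcut is a collection of subgraphs $H_1,\dots,H_k$ of $G$. Its congestion is the maximum, over edges $e\in E$, of the number of indices $i$ with $e\in H_i$. Its dilation is the maximum over $i$ of the diameter of the graph $G[P_i]+H_i$, whose vertex set is $P_i\cup V(H_i)$ and whose edge set is the union of the edges of $G[P_i]$ and of $H_i$. *)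

(* Defs.v *)
From HB Require Import structures.
From mathcomp Require Import all_boot all_order all_algebra.
From mathcomp Require Import all_classical all_reals all_analysis.

Set Implicit Arguments.
Unset Strict Implicit.
Unset Printing Implicit Defensive.

Import Order.TTheory GRing.Theory Num.Theory.

Local Open Scope ring_scope.

(* A finite simple graph whose vertices are drawn from an ambient finite type
   T: a vertex set V together with a set E of two-element subsets of V.
   Subgraphs and minors of a graph then live over the same type T, and
   [graph T] is itself a finite type. *)
Definition graph_axiom (T : finType) (VE : {set T} * {set {set T}}) : bool :=
  [forall f in VE.2, (f \subset VE.1) && (#|f| == 2%N)].

Record graph (T : finType) := Graph {
  graph_val : {set T} * {set {set T}};
  _ : graph_axiom graph_val }.

HB.instance Definition _ (T : finType) := [isSub for @graph_val T].
HB.instance Definition _ (T : finType) := [Finite of graph T by <:].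

Definition verts (T : finType) (G : graph T) : {set T} := (graph_val G).1.
Definition edges (T : finType) (G : graph T) : {set {set T}} :=
  (graph_val G).2.

Lemma mkgraph_subproof (T : finType) (V : {set T}) (E : {set {set T}}) :
  graph_axiom (V, [set f in E | (f \subset V) && (#|f| == 2%N)]).
Proof. by apply/'forall_implyP => f; rewrite inE => /andP[]. Qed.

(* Members of E that are not two-element subsets of V (loops, edges with a
   removed endpoint) are discarded. *)
Definition mkgraph (T : finType) (V : {set T}) (E : {set {set T}}) : graph T :=
  Graph (mkgraph_subproof V E).

Definition gadj (T : finType) (G : graph T) : rel T :=
  fun x y => [set x; y] \in edges G.

Definition gconnected (T : finType) (G : graph T) : Prop :=
  verts G != finset.set0 /\ {in verts G &, forall x y, connect (gadj G) x y}.

Definition subgraph (T : finType) (H G : graph T) : Prop :=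
  verts H \subset verts G /\ edges H \subset edges G.

Definition induced_subgraph (T : finType) (G : graph T) (P : {set T}) : graph T :=
  mkgraph (verts G :&: P) (edges G).

Definition gunion (T : finType) (G H : graph T) : graph T :=
  mkgraph (verts G :|: verts H) (edges G :|: edges H).

(* Infimum of the lengths (numbers of edges) of the walks from x to y;
   it is +oo when y is not reachable from x. *)
Definition dist (R : realType) (T : finType) (G : graph T) (x y : T) : \bar R :=
  ereal_inf [set ((size p)%:R)%:E |
    p in [set p : seq T | path (gadj G) x p /\ last x p = y]%classic]%classic.

Definition diameter (R : realType) (T : finType) (G : graph T) : \bar R :=
  \big[maxe/0%E]_(x in verts G) \big[maxe/0%E]_(y in verts G) dist R G x y.

Definition del_vertex (T : finType) (G : graph T) (v : T) : graph T :=
  mkgraph (verts G :\ v) (edges G).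

Definition del_edge (T : finType) (G : graph T) (f : {set T}) : graph T :=
  mkgraph (verts G) (edges G :\ f).

(* The vertex obtained by contracting the edge xy is again called x.  Parallel
   edges are merged, and the loop coming from xy is discarded by [mkgraph]. *)
Definition contract_edge (T : finType) (G : graph T) (x y : T) : graph T :=
  mkgraph (verts G :\ y)
    [set [set (if z == y then x else z) | z in f] | f : {set T} in edges G].

Definition minor_step (T : finType) : rel (graph T) := fun G H =>
  [|| [exists v in verts G, H == del_vertex G v],
      [exists f in edges G, H == del_edge G f] |
      [exists x, exists y, gadj G x y && (H == contract_edge G x y)]].

(* A vertex of a minor of G keeps the name of one of the vertices of G that
   were contracted into it; every minor of G is thus represented, up to
   isomorphism, by a graph over the same type T. *)
Definition minor (T : finType) (H G : graph T) : bool :=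
  connect (@minor_step T) G H.

(* The graph without vertices contributes 0 / 0 = 0 to the maximum. *)
Definition minor_density (R : realType) (T : finType) (G : graph T) : R :=
  \big[Num.max/0]_(H : graph T | minor H G)
    (#|edges H|%:R / #|verts H|%:R).

Definition connected_partition (T : finType) (G : graph T) (k : nat)
    (P : 'I_k -> {set T}) : Prop :=
  [/\ injective P,
      finset.partition [set P i | i : 'I_k] (verts G) &
      forall i, gconnected (induced_subgraph G (P i))].

Definition shortcut (T : finType) (G : graph T) (k : nat)
    (H : 'I_k -> graph T) : Prop :=
  forall i, subgraph (H i) G.

Definition congestion (T : finType) (G : graph T) (k : nat)
    (H : 'I_k -> graph T) : nat :=
  \max_(f in edges G) #|[set i | f \in edges (H i)]|.

Definition dilation (R : realType) (T : finType) (G : graph T) (k : nat)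
    (P : 'I_k -> {set T}) (H : 'I_k -> graph T) : \bar R :=
  \big[maxe/0%E]_(i < k) diameter R (gunion (induced_subgraph G (P i)) (H i)).

(* Main.v *)
Require Import Defs.
From HB Require Import structures.
From mathcomp Require Import all_boot all_order all_algebra.
From mathcomp Require Import zify ring lra.

Set Implicit Arguments.
Unset Strict Implicit.
Unset Printing Implicit Defensive.

Import Order.TTheory GRing.Theory Num.Theory.

(* Fix a BFS tree of depth D. Going from the leaves to the root, cut every tree
   edge that at least 12 delta D parts can reach by climbing along uncut edges,
   and give each part the uncut edges it climbs along: congestion is at most
   12 delta D, and a part attached to few cut edges has dilation O(delta D),
   because its shortcut consists of few subtrees of depth D.
   Keep each part with probability 1 / (2 D). Contracting the kept parts, and
   for each cut edge the vertices that climb to it without meeting a kept part,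
   gives a minor that retains in expectation a 1 / (4 D) fraction of the
   (cut edge, part) incidences. Its density being at most delta, there are at
   most 4 delta incidences per part on average, so at least half of the parts
   have at most 8 delta of them. Serve those and recurse on the others: the
   number of rounds is logarithmic and the congestions add up. *)

(** * Minors as quotients *)

Lemma connect_homo (T1 T2 : finType) (e1 : rel T1) (e2 : rel T2) (g : T1 -> T2) :
    (forall a b, e1 a b -> connect e2 (g a) (g b)) ->
  forall a b, connect e1 a b -> connect e2 (g a) (g b).
Proof.
move=> e12 a b /connectP[p]; elim: p a => [|c p IHp] a /= => [_ -> //|].
by case/andP=> /e12 ac cp /(IHp c cp); apply: connect_trans.
Qed.

Section Graphs.
Variable T : finType.
Implicit Types (G H : graph T) (U V : {set T}) (E : {set {set T}}) (r : T -> T).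

Lemma edge_sub G f : f \in edges G -> f \subset verts G /\ #|f| = 2.
Proof.
case: G => -[V E] ax; rewrite /edges /verts /= => fE.
by have /forallP/(_ f)/implyP/(_ fE)/andP[? /eqP] := ax.
Qed.

Lemma gadj_sym G : symmetric (gadj G).
Proof. by move=> x y; rewrite /gadj setUC. Qed.

Lemma gadjW G x y : gadj G x y -> [/\ x \in verts G, y \in verts G & x != y].
Proof.
move=> /edge_sub[]; rewrite subUset !sub1set cards2 => /andP[-> ->].
by case: (x == y).
Qed.

Lemma graph_eq G H : verts G = verts H -> edges G = edges H -> G = H.
Proof.
by move=> eV eE; apply: val_inj; move: eV eE; rewrite /verts /edges /=;
  case: (graph_val G) (graph_val H) => [? ?] [? ?] /= -> ->.
Qed.

Lemma verts_mkgraph V E : verts (mkgraph V E) = V.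
Proof. by []. Qed.

Lemma edges_mkgraph V E f :
  (f \in edges (mkgraph V E)) = [&& f \in E, f \subset V & #|f| == 2].
Proof. by rewrite inE. Qed.

Lemma gadj_mkgraph V E x y :
  gadj (mkgraph V E) x y = [&& [set x; y] \in E, x \in V, y \in V & x != y].
Proof.
rewrite /gadj edges_mkgraph subUset !sub1set cards2 andbA.
by case: (x == y); rewrite ?andbF ?andbT ?andbA.
Qed.

Lemma minor_trans G1 G2 G3 : minor G1 G2 -> minor G2 G3 -> minor G1 G3.
Proof. by move=> m12 m23; apply: connect_trans m23 m12. Qed.

Lemma induced_minor G U : minor (induced_subgraph G U) G.
Proof.
have [n] := ubnP #|verts G :\: U|; elim: n G => // n IHn G ltn.
have [VU|[v]] := set_0Vmem (verts G :\: U).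
  suff -> : induced_subgraph G U = G by apply: connect0.
  have VsU : verts G :&: U = verts G.
    by apply/setIidPl; rewrite -setD_eq0 VU.
  apply: graph_eq; rewrite /induced_subgraph VsU ?verts_mkgraph //.
  apply/setP=> f; rewrite edges_mkgraph.
  by case fE: (f \in edges G) => //=; have [-> ->] := edge_sub fE.
rewrite inE => /andP[vU vV].
have m1 : minor (del_vertex G v) G.
  by apply: connect1; apply/or3P/Or31; apply/existsP; exists v; rewrite vV /=.
apply: minor_trans m1.
have -> : induced_subgraph G U = induced_subgraph (del_vertex G v) U.
  have eV : verts G :&: U = (verts G :\ v) :&: U.
    apply/setP=> x; rewrite !inE; case: eqP => // -> /=.
    by rewrite (negPf vU) andbF.
  apply: graph_eq; rewrite /induced_subgraph !verts_mkgraph ?eV //.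
  apply/setP=> f; rewrite !edges_mkgraph.
  case fE: (f \in edges G) => //=; rewrite subsetI.
  by case: (f \subset _) => //=; rewrite ?andbF //; case: (#|f| == 2); rewrite ?andbF.
apply: IHn; rewrite verts_mkgraph.
rewrite -ltnS; apply: leq_trans ltn; rewrite ltnS; apply: proper_card.
apply/properP; split; first by apply/subsetP=> x; rewrite !inE => /and3P[-> _ ->].
by exists v; rewrite !inE ?vU ?vV ?eqxx.
Qed.

(** Contraction of all fibres of [r] at once: an edge inside a fibre becomes a singleton, which
    [mkgraph] discards. *)
Definition qgraph r G : graph T :=
  mkgraph (r @: verts G) [set r @: (f : {set T}) | f in edges G].

Lemma edges_qgraph r G f :
  (f \in edges (qgraph r G)) =
  (f \in [set r @: (f : {set T}) | f in edges G]) && (#|f| == 2).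
Proof.
rewrite edges_mkgraph; case: imsetP => //= -[g gE ->].
by rewrite imsetS //; case: (edge_sub gE).
Qed.

Lemma eq_qgraph r1 r2 G : r1 =1 r2 -> qgraph r1 G = qgraph r2 G.
Proof.
move=> r12; rewrite /qgraph (eq_imset _ r12); congr mkgraph.
by apply: eq_imset => f; apply: eq_imset.
Qed.

Lemma qgraph_comp r1 r2 G : qgraph r2 (qgraph r1 G) = qgraph (r2 \o r1) G.
Proof.
apply: graph_eq; first by rewrite !verts_mkgraph imset_comp.
apply/setP=> f; rewrite !edges_qgraph; case f2: (#|f| == 2); rewrite ?andbF //.
rewrite !andbT; apply/imsetP/imsetP => -[g].
  rewrite edges_qgraph => /andP[/imsetP[h hE ->] _] ->.
  by exists h; rewrite // imset_comp.
move=> gE fE; exists (r1 @: g); last by rewrite fE imset_comp.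
(* An edge that survives the composite survives [r1]: it has size 2 before and after, and images
   never grow. *)
rewrite edges_qgraph imset_f //= eqn_leq.
have [_ g2] := edge_sub gE; rewrite -{1}g2 leq_imset_card -(eqP f2) fE.
by rewrite imset_comp leq_imset_card.
Qed.

Lemma qgraph_id r G : {in verts G, forall v, r v = v} -> qgraph r G = G.
Proof.
move=> rid; have idf (f : {set T}) : f \subset verts G -> r @: f = f.
  move=> /subsetP fV; rewrite -[RHS]imset_id; apply: eq_in_imset => x /fV.
  exact: rid.
apply: graph_eq; first by rewrite verts_mkgraph idf.
apply/setP=> f; rewrite edges_qgraph; apply/andP/idP => [[/imsetP[g gE ->] _]|fE].
  by rewrite idf //; case: (edge_sub gE).
have [fV /eqP f2] := edge_sub fE; split=> //.
by apply/imsetP; exists f; rewrite ?idf.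
Qed.

Lemma contract_edgeE G x y : gadj G x y ->
  contract_edge G x y = qgraph (fun z => if z == y then x else z) G.
Proof.
move=> /gadjW[xV yV xy]; rewrite /contract_edge /qgraph; congr mkgraph.
apply/setP=> z; rewrite !inE; apply/andP/imsetP => [[zy zV]|[t tV ->]].
  by exists z; rewrite // (negPf zy).
by case: (eqVneq t y) => [_|ty]; split.
Qed.

(** Induction on the number of vertices that [r] moves. On a walk from a moved [v] to [r v] inside
    its fibre, the last edge is contracted towards [r v]; this removes a moved vertex, and [r]
    factors through the contraction. *)
Lemma qgraph_minor r G :
    {in verts G, forall v,
       connect [rel a b | gadj G a b && (r a == r b)] v (r v)} ->
  minor (qgraph r G) G.
Proof.
have [n] := ubnP #|[set v in verts G | r v != v]|.
elim: n G => // n IHn G ltn conn.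
have [all_id|[v]] := set_0Vmem [set v in verts G | r v != v].
  rewrite qgraph_id ?/minor ?connect0 // => v vV; apply/eqP/negbNE/negP=> rv.
  by have := in_set0 v; rewrite -all_id inE vV rv.
rewrite inE => /andP[vV rv].
have fib a b : connect [rel a b | gadj G a b && (r a == r b)] a b -> r a = r b.
  case/connectP=> p; elim: p a => [|c p IHp] a /= => [_ -> //|].
  by case/andP=> /andP[_ /eqP ->] cp /(IHp c cp).
have rr w : w \in verts G -> r (r w) = r w by move=> /conn/fib.
have [p] := connectP (conn v vV); case/lastP: p => [_ /= E|p x].
  by rewrite E eqxx in rv.
rewrite last_rcons rcons_path => /andP[_ /andP[adj /eqP rur]] xE.
set u := last v p in adj rur; rewrite gadj_sym in adj.
have rx : r x = x by rewrite -xE rr.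
pose r1 z := if z == u then x else z.
have [xV uV xu] := gadjW adj.
have rr1 : r \o r1 =1 r.
  by move=> z /=; rewrite /r1; case: eqP => // ->.
have G1E := contract_edgeE adj; rewrite -/r1 in G1E.
apply: (@minor_trans _ (contract_edge G x u)); last first.
  apply: connect1; apply/or3P/Or33; apply/existsP; exists x; apply/existsP.
  by exists u; rewrite adj /=.
rewrite -(eq_qgraph G rr1) -qgraph_comp -G1E; apply: IHn.
  rewrite -ltnS; apply: leq_trans ltn; rewrite ltnS; apply: proper_card.
  apply/properP; split.
    by apply/subsetP=> z; rewrite !inE -!andbA => /and3P[_ -> ->].
  by exists u; rewrite !inE ?eqxx // uV rur rx.
move=> w; rewrite !inE => /andP[wu wV].
have -> : w = r1 w by rewrite /r1 (negPf wu).
(* The vertex contracted away is not fixed by [r], hence differs from [r w]. *)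
have -> : r (r1 w) = r1 (r w).
  have := rr1 w; rewrite /= => ->; rewrite /r1; case: eqP => // rwu.
  by have := rr w wV; rewrite rwu rur rx.
apply: connect_homo (conn w wV) => a b /= /andP[ab /eqP rab].
have [-> //|ne] := eqVneq (r1 a) (r1 b).
apply: connect1 => /=; have := rr1 a; have := rr1 b => /= -> ->.
rewrite rab eqxx andbT G1E /gadj edges_qgraph cards2 ne andbT.
by apply/imsetP; exists [set a; b]; rewrite // imsetU1 imset_set1.
Qed.

(** Counting form of a minor model: the fibres of [r] on [U] are the branch sets, and [F] consists
    of pairs of distinct adjacent ones. Deleting the vertices outside [U] and contracting the fibres
    gives a minor that has all of [F] among its edges. *)
Lemma model_edges_le (R : numDomainType) (delta : R) G U r (F : {set {set T}}) :
    (forall H, minor H G -> (#|edges H|%:R <= delta * #|verts H|%:R)%R) ->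
    U \subset verts G ->
    {in U, forall v, connect
       [rel a b | [&& gadj G a b, a \in U, b \in U & r a == r b]] v (r v)} ->
    (forall f, f \in F -> exists u v,
       [/\ gadj G u v, u \in U, v \in U, r u != r v & f = [set r u; r v]]) ->
  (#|F|%:R <= delta * #|r @: U|%:R)%R.
Proof.
move=> dens UV conn FP; have /setIidPr VU := UV.
have mH : minor (qgraph r (induced_subgraph G U)) G.
  apply: minor_trans (induced_minor G U); apply: qgraph_minor => v.
  rewrite verts_mkgraph VU => vU; apply: connect_sub (conn v vU) => a b /=.
  case/and4P=> ab aU bU rab; apply: connect1; rewrite /= rab andbT.
  by rewrite gadj_mkgraph VU aU bU; case: (gadjW ab) => _ _ ->; rewrite !andbT.
have := dens _ mH; rewrite {2}/qgraph !verts_mkgraph VU; apply: le_trans.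
rewrite ler_nat; apply: subset_leq_card; apply/subsetP=> f.
case/FP=> u [v [uv uU vU ne ->]]; rewrite edges_qgraph cards2 ne andbT.
apply/imsetP; exists [set u; v]; last by rewrite imsetU1 imset_set1.
rewrite edges_mkgraph VU subUset !sub1set uU vU cards2.
by case: (gadjW uv) => _ _ ->; rewrite !andbT.
Qed.

End Graphs.

(** * Climbing in a rooted tree *)

Section Climbing.
Variables (T : finType) (V : {set T}) (root : T) (par : T -> T).
Variables (d : T -> nat) (D : nat).
Hypothesis parP :
  {in V, forall v, v != root -> par v \in V /\ d (par v) < d v}.
Hypothesis d_le : {in V, forall v, d v <= D}.
Implicit Types (O : {set T}) (u v w : T).

(** Stopping vertices are fixed points, so climbing is the iteration of a total function, and [D]
    iterations from a vertex of [V] always reach a stopping vertex. *)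
Definition climb O u := if (u == root) || (u \in O) then u else par u.

Definition climb_top O u := iter D (climb O) u.

Lemma climbV O u : u \in V -> climb O u \in V.
Proof.
by move=> uV; rewrite /climb; case: (eqVneq u root) => //= ur; case: ifP => // _;
  case: (parP uV ur).
Qed.

Lemma iter_climbV O j u : u \in V -> iter j (climb O) u \in V.
Proof. by move=> uV; elim: j => //= j; apply: climbV. Qed.

Lemma climb_stop O u : u \in V -> climb O u = u -> u = root \/ u \in O.
Proof.
move=> uV; rewrite /climb; case: (eqVneq u root) => /= [-> _|ur]; first by left.
case: ifP => [uO _|_ pu]; first by right.
by have [_] := parP uV ur; rewrite pu ltnn.
Qed.

Lemma climb_id O u : u \in O -> climb O u = u.
Proof. by move=> uO; rewrite /climb uO orbT. Qed.

Lemma climb_lt O u : u \in V -> climb O u != u -> d (climb O u) < d u.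
Proof.
move=> uV; rewrite /climb; case: (eqVneq u root) => /= [->|ur]; first by rewrite eqxx.
by case: ifP => [_|_ _]; rewrite ?eqxx //; case: (parP uV ur).
Qed.

Lemma climb_le O u : u \in V -> d (climb O u) <= d u.
Proof.
by move=> uV; have [-> //|/(climb_lt uV)/ltnW] := eqVneq (climb O u) u.
Qed.

Lemma iter_climb_le O j u : u \in V -> d (iter j (climb O) u) <= d u.
Proof.
move=> uV; elim: j => //= j; apply: leq_trans.
by apply: climb_le; apply: iter_climbV.
Qed.

Lemma climb_climb_top O u : u \in V -> climb O (climb_top O u) = climb_top O u.
Proof.
move=> uV; rewrite /climb_top; have := d_le uV.
elim: D u uV => [|n IHn] u uV dn.
  apply/eqP/negPn/negP => /(climb_lt uV).
  by rewrite ltnNge (leq_trans dn).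
rewrite iterSr; have [fu|/(climb_lt uV) lt] := eqVneq (climb O u) u.
  by rewrite fu iter_fix.
by apply: IHn; [apply: climbV | rewrite -ltnS (leq_trans lt)].
Qed.

Lemma climb_top_id O v : climb O v = v -> climb_top O v = v.
Proof. exact: iter_fix. Qed.

Lemma climb_top_iter O j u :
  u \in V -> climb_top O (iter j (climb O) u) = climb_top O u.
Proof.
move=> uV; rewrite /climb_top -iterD addnC iterD iter_fix //.
exact: climb_climb_top.
Qed.

Lemma climb_topP O u v : u \in V -> climb O v = v ->
  reflect (climb_top O u = v) (fconnect (climb O) u v).
Proof.
move=> uV fv; apply: (iffP idP) => [/iter_findex vE|<-].
  by rewrite -(climb_top_iter O (findex (climb O) u v) uV) vE climb_top_id.
exact: fconnect_iter.
Qed.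

Lemma fconnect_climbV O u v : u \in V -> fconnect (climb O) u v -> v \in V.
Proof. by move=> uV /iter_findex <-; apply: iter_climbV. Qed.

(** Before it reaches [v], a climb only passes vertices strictly deeper than [v], where both sets
    agree. *)
Lemma fconnect_climb_local O1 O2 u v :
    {in V, forall w, d v < d w -> (w \in O1) = (w \in O2)} -> u \in V ->
  fconnect (climb O1) u v -> fconnect (climb O2) u v.
Proof.
move=> O12 uV /iter_findex; move: (findex _ _ _) => j.
elim: j u uV => [|j IHj] u uV; first by move=> /= ->.
rewrite iterSr => jv; have := IHj _ (climbV O1 uV) jv.
have [-> //|/(climb_lt uV) lt] := eqVneq (climb O1 u) u.
apply: connect_trans; apply: connect1; apply/eqP.
rewrite /climb O12 //; apply: leq_ltn_trans lt.
by rewrite -jv iter_climb_le ?climbV.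
Qed.

(* Whether v satisfies F O only depends on the part of O that is deeper than v,
   so O can be determined level by level, from the leaves upwards. *)
Lemma bottom_up_fixpoint (F : {set T} -> T -> bool) :
    (forall O1 O2 v, v \in V ->
       {in V, forall w, d v < d w -> (w \in O1) = (w \in O2)} ->
       F O1 v = F O2 v) ->
  exists O : {set T}, O \subset V /\ {in V, forall v, (v \in O) = F O v}.
Proof.
move=> Floc; pose step O := [set v in V | F O v].
(* Each iteration settles one more level, deepest first; [D.+1] iterations cover the depths from [D]
   down to 0. *)
have stab h v : v \in V -> D < d v + h ->
    (v \in iter h step set0) = F (iter h step set0) v.
  elim: h v => [|h IHh] v vV; first by rewrite addn0 ltnNge d_le.
  move=> Dh; rewrite [LHS]/= inE vV /=; apply: Floc => // w wV lt.
  rewrite [RHS]/= inE wV /=; apply: IHh => //.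
  by rewrite (leq_trans Dh) // addnS -addSn leq_add2r.
exists (iter D.+1 step set0); split; last first.
  by move=> v vV; apply: stab => //; rewrite addnS ltnS leq_addl.
by apply/subsetP=> v; rewrite inE => /andP[].
Qed.

End Climbing.

(** * Sampling *)

Lemma sum_bool_card (I : finType) (P : pred I) : \sum_i (P i : nat) = #|[set i | P i]|.
Proof.
by rewrite -sum1dep_card [RHS]big_mkcond /=; apply: eq_bigr => i _; case: (P i).
Qed.

(** A uniform random function into [m.+1] values vanishes on [Y] with probability [(m+1)^-|Y|],
    written as a count. *)
Lemma card_vanishing (I : finType) m (Y : {set I}) :
  #|[set f : {ffun I -> 'I_m.+1} | [forall i in Y, f i == ord0]]| * m.+1 ^ #|Y| =
  m.+1 ^ #|I|.
Proof.
rewrite -[RHS](_ : m.+1 ^ #|~: Y| * m.+1 ^ #|Y| = _); last first.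
  by rewrite -expnD addnC cardsC.
congr (_ * _); transitivity (#|'I_m.+1| ^ #|~: Y|); last by rewrite card_ord.
rewrite -(card_pffun_on (ord0 : 'I_m.+1)).
apply: eq_card => f; rewrite inE; apply/forall_inP/pffun_onP => [Y0|[/supportP Y0 _]].
  split=> //; apply/supportP => i; rewrite inE negbK => /Y0 /eqP //.
by move=> i iY; apply/eqP/Y0; rewrite inE negbK.
Qed.

(* Average over a random S that retains each index of A with probability
   1 / (2 D): an element b of J is then counted with probability at least
   1 / (4 D). *)
Lemma sampling_bound (R : realFieldType) (I B : finType) (A : {set I})
    (J : {set B}) (idx : B -> I) (X : B -> {set I}) (D o : nat) (delta : R) :
    0 < D ->
    {in J, forall b, [/\ idx b \in A, idx b \notin X b & #|X b| <= D]} ->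
    (forall S : {set I}, S \subset A ->
       (#|[set b in J | (idx b \in S) && [disjoint S & X b]]|%:R <=
        delta * (#|S| + o)%:R)%R) ->
  (#|J|%:R <= 2 * delta * #|A|%:R + 4 * D%:R * delta * o%:R)%R.
Proof.
move=> D0 JP bound.
(* An index is retained when [f] sends it to [ord0]. With [2 D] values this has probability
   [1 / (2 D)], and [1 / (4 D^2)] for two distinct indices jointly. *)
have [m mE] : exists m, m.+1 = 2 * D by exists (2 * D).-1; lia.
pose F := {ffun I -> 'I_m.+1}; pose N := m.+1 ^ #|I|.
have c1 i : \sum_(f : F) (f i == ord0 : nat) * (2 * D) = N.
  rewrite -big_distrl /= sum_bool_card -mE /N -(card_vanishing m [set i]) cards1 expn1.
  congr (_ * _); apply: eq_card => f; rewrite !inE.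
  apply/idP/forall_inP => [? j /set1P -> //|]; apply; exact: set11.
have c2 i j : i != j ->
    \sum_(f : F) ((f i == ord0) && (f j == ord0) : nat) * (4 * D ^ 2) = N.
  move=> ij; rewrite -big_distrl /= sum_bool_card.
  have -> : 4 * D ^ 2 = m.+1 ^ 2 by rewrite mE; lia.
  rewrite /N -(card_vanishing m [set i; j]) cards2 ij.
  congr (_ * _); apply: eq_card => f; rewrite !inE.
  apply/andP/forall_inP => [[? ?] l /set2P[] -> //|Y0].
  by rewrite !Y0 ?set21 ?set22.
pose S (f : F) := [set i in A | f i == ord0].
pose W f := [set b in J | (idx b \in S f) && [disjoint S f & X b]].
have sumS : (\sum_f #|S f|) * (2 * D) = #|A| * N.
  rewrite (eq_bigr (fun f : F => \sum_(i in A) (f i == ord0 : nat))); last first.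
    move=> f _; rewrite -sum1_card [RHS]big_mkcond [LHS]big_mkcond /=.
    by apply: eq_bigr => i _; rewrite inE; case: (i \in A); case: (f i == ord0).
  rewrite exchange_big big_distrl /= -sum_nat_const; apply: eq_bigr => i _.
  by rewrite -(c1 i) big_distrl.
have sumW : #|J| * N <= (\sum_f #|W f|) * (4 * D).
  rewrite (eq_bigr (fun f : F =>
    \sum_(b in J) ((idx b \in S f) && [disjoint S f & X b] : nat))); last first.
    move=> f _; rewrite -sum1_card [RHS]big_mkcond [LHS]big_mkcond /=.
    by apply: eq_bigr => b _; rewrite inE; case: (b \in J) => //=; case: ifP.
  rewrite exchange_big big_distrl /= -sum_nat_const; apply: leq_sum => b bJ.
  have [iA iX XD] := JP b bJ; set i := idx b in iA iX *.
  set s := \sum_f _.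
  (* Union bound, scaled by [4 D^2 N]: the probability of counting [b] is at least
     [1 / (2 D) - D / (4 D^2) = 1 / (4 D)]. *)
  have le1 : N * (2 * D) <= s * (4 * D ^ 2) + D * N.
    have -> : N * (2 * D) = (\sum_(f : F) (f i == ord0 : nat)) * (4 * D ^ 2).
      by rewrite -(c1 i) -big_distrl /= -mulnA -mulnn; congr (_ * _); nia.
    have le2 : \sum_(j in X b)
        (\sum_(f : F) ((f i == ord0) && (f j == ord0) : nat)) * (4 * D ^ 2) <= D * N.
      rewrite (eq_bigr (fun=> N)); first by rewrite sum_nat_const leq_mul2r XD orbT.
      move=> j jX; rewrite big_distrl /= c2 //.
      by apply: contraNneq iX => ->.
    apply: leq_trans (leq_add (leqnn _) le2).
    rewrite -big_distrl /= -mulnDl leq_mul2r; apply/orP; right.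
    rewrite exchange_big /= /s -big_split /=; apply: leq_sum => f _.
    case fi: (f i == ord0) => //=; rewrite inE iA fi /=.
    have [//|/pred0Pn[j /andP[/=]]] := boolP [disjoint _ & _].
    rewrite inE => /andP[_ fj] jX.
    by rewrite (bigD1 j) //= fj.
  move: le1 D0; rewrite -mulnn; nia.
have N0 : 0 < N by rewrite expn_gt0.
have {}sumW : (#|J|%:R * N%:R <= (\sum_f #|W f|%:R) * (4 * D%:R) :> R)%R.
  by rewrite -natr_sum -!natrM ler_nat.
have {}sumS : ((\sum_f #|S f|%:R) * (2 * D%:R) = #|A|%:R * N%:R :> R)%R.
  by rewrite -natr_sum -!natrM sumS.
have le : (\sum_f #|W f|%:R <= delta * (\sum_f #|S f|%:R) + delta * o%:R * N%:R :> R)%R.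
  have -> : (delta * o%:R * N%:R = \sum_(f : F) (delta * o%:R) :> R)%R.
    by rewrite sumr_const card_ffun card_ord -[RHS]mulr_natr.
  rewrite mulr_sumr -big_split /=; apply: ler_sum => f _.
  rewrite -mulrDr -natrD; apply: bound.
  by apply/subsetP => i; rewrite inE => /andP[].
have N0R : (0 < N%:R :> R)%R by rewrite ltr0n.
rewrite -(ler_pM2r N0R).
apply: le_trans sumW _.
have -> : ((2 * delta * #|A|%:R + 4 * D%:R * delta * o%:R) * N%:R =
   (delta * (\sum_f #|S f|%:R) + delta * o%:R * N%:R) * (4 * D%:R) :> R)%R.
  have -> : ((2 * delta * #|A|%:R + 4 * D%:R * delta * o%:R) * N%:R =
   2 * delta * (#|A|%:R * N%:R) + 4 * D%:R * delta * o%:R * N%:R :> R)%R by ring.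
  by rewrite -sumS; ring.
by rewrite ler_wpM2r // mulr_ge0 ?ler0n.
Qed.

(** * Distances through hubs *)

Section Walks.
Variable T : finType.
Implicit Types (G K : graph T) (x y z : T).

(** Integer counterpart of an upper bound on [dist]. *)
Definition walk_le G n x y : Prop :=
  exists p, [/\ path (gadj G) x p, last x p = y & size p <= n].

Lemma walk_le0 G n x : walk_le G n x x.
Proof. by exists [::]. Qed.

Lemma walk_le1 G x y : gadj G x y -> walk_le G 1 x y.
Proof. by move=> xy; exists [:: y]; rewrite /= xy. Qed.

Lemma walk_le_trans G m n x y z :
  walk_le G m x y -> walk_le G n y z -> walk_le G (m + n) x z.
Proof.
move=> [p [xp <- sp]] [q [yq <- sq]]; exists (p ++ q).
by rewrite cat_path xp yq last_cat size_cat leq_add.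
Qed.

Lemma walk_le_weaken G m n x y : m <= n -> walk_le G m x y -> walk_le G n x y.
Proof. by move=> mn [p [xp py sp]]; exists p; split=> //; apply: leq_trans mn. Qed.

Lemma walk_le_sym G n x y : walk_le G n x y -> walk_le G n y x.
Proof.
move=> [p [xp <- sp]]; exists (rev (belast x p)); split; last 1 first.
- by rewrite size_rev size_belast.
- rewrite rev_path; apply: sub_path xp => a b; by rewrite gadj_sym.
- by case: (p) => //= a q; rewrite rev_cons last_rcons.
Qed.

(** Two hubs count as adjacent when an edge of [K] joins vertices assigned to them. A
    repetition-free path of hubs has fewer than [#|Q|] steps, each realized by at most [2 D + 1]
    edges; getting from [x] to its hub and from the last hub to [y] costs [D] each. *)
Lemma hub_walk_le K (h : T -> T) (Q : {set T}) D :
    {in verts K, forall x, h x \in Q /\ walk_le K D x (h x)} ->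
    {in verts K &, forall x y, connect (gadj K) x y} ->
  {in verts K &, forall x y, walk_le K (#|Q| * D.*2.+1) x y}.
Proof.
move=> hP conn x y xK yK.
pose q s t := [exists u, exists v, [&& gadj K u v, h u == s & h v == t]].
have qP s t : reflect (exists u v, [/\ gadj K u v, h u = s & h v = t]) (q s t).
  apply: (iffP existsP) => [[u /existsP[v /and3P[uv /eqP us /eqP vt]]]|].
    by exists u, v.
  by move=> [u [v [uv <- <-]]]; exists u; apply/existsP; exists v; rewrite uv !eqxx.
have : connect q (h x) (h y).
  apply: connect_homo (conn x y xK yK) => a b ab.
  by apply: connect1; apply/qP; exists a, b.
case/connectP=> p0; case/shortenP=> p xp Up _ pE.
have pQ : {subset h x :: p <= Q}.
  move: xp {Up pE}; have : h x \in Q by case: (hP x xK).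
  elim: p (h x) => [|t p IHp] s sQ /=; first by move=> _ z; rewrite inE => /eqP ->.
  case/andP=> /qP[u [v [/gadjW[_ vK _] _ vt]]] tp z.
  rewrite inE => /predU1P[-> //|]; apply: IHp tp z.
  by rewrite -vt; case: (hP v vK).
have szp : size p < #|Q|.
  rewrite -[_.+1]/(size (h x :: p)) -(card_uniqP Up) subset_leq_card //.
  exact: (introT subsetP pQ).
have reach s : path q s p -> walk_le K (size p * D.*2.+1) s (last s p).
  elim: p s {xp Up pE pQ szp} => [|t p IHp] s /= => [_|]; first exact: walk_le0.
  case/andP=> /qP[u [v [uv us vt]]] /IHp; rewrite mulSn; apply: walk_le_trans.
  have [uK vK _] := gadjW uv.
  have [_ hu] := hP u uK; have [_ hv] := hP v vK.
  rewrite -us -vt -addnn -addSn -addn1.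
  apply: walk_le_trans hv; apply: walk_le_trans (walk_le1 uv).
  exact: walk_le_sym.
have [_ hx] := hP x xK; have [_ /walk_le_sym hy] := hP y yK.
have := reach _ xp; rewrite -pE => hxy.
apply: walk_le_weaken (walk_le_trans (walk_le_trans hx hxy) hy).
by apply: leq_trans (leq_mul szp (leqnn D.*2.+1)); lia.
Qed.

End Walks.

(** * One round *)

Section Round.
Variables (R : realFieldType) (T I : finType) (G : graph T) (delta : R).
Variables (root : T) (par : T -> T) (d : T -> nat) (D : nat).
Variables (P : I -> {set T}) (A : {set I}).
Local Notation V := (verts G).
Hypothesis par_adj : {in V, forall v, v != root -> gadj G v (par v)}.
Hypothesis par_lt : {in V, forall v, v != root -> d (par v) < d v}.
Hypothesis d_le : {in V, forall v, d v <= D}.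
Hypothesis D_gt0 : 0 < D.
Hypothesis delta_ge : (1 <= 2 * delta)%R.
Hypothesis density : forall H, minor H G -> (#|edges H|%:R <= delta * #|verts H|%:R)%R.
Hypothesis P_sub : {in A, forall i, P i \subset V}.
Hypothesis P_conn : {in A, forall i, gconnected (induced_subgraph G (P i))}.
Hypothesis P_disj : {in A &, forall i j x, x \in P i -> x \in P j -> i = j}.

Let parP : {in V, forall v, v != root -> par v \in V /\ d (par v) < d v}.
Proof.
by move=> v vV vr; rewrite par_lt //; case: (gadjW (par_adj vV vr)).
Qed.

Let delta_gt0 : (0 < delta)%R.
Proof. by move: delta_ge; lra. Qed.

Local Notation step := (climb root par).
Local Notation top := (climb_top root par D).

(* A cut tree edge is encoded by its lower endpoint; O is the set of these
   endpoints, at which climbing stops. *)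
Definition users (O : {set T}) v : {set I} :=
  [set i in A | [exists u in P i, fconnect (step O) u v]].

Lemma usersP O v i :
  reflect (i \in A /\ exists2 u, u \in P i & fconnect (step O) u v)
          (i \in users O v).
Proof. by rewrite inE; apply: (iffP andP) => -[iA /exists_inP]. Qed.

Lemma PV i u : i \in A -> u \in P i -> u \in V.
Proof. by move=> iA; apply/subsetP/P_sub. Qed.

Lemma climb_adj O u : u \in V -> step O u != u -> gadj G u (step O u).
Proof.
move=> uV; rewrite /climb; case: (eqVneq u root) => /= [->|ur]; first by rewrite eqxx.
by case: ifP => [|_ _]; rewrite ?eqxx //; apply: par_adj.
Qed.

Definition owner x := [pick i in A | x \in P i].

Lemma ownerP x i : reflect (i \in A /\ x \in P i) (owner x == Some i).
Proof.
rewrite /owner; case: pickP => [j /andP[jA xj]|no].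
  by apply: (iffP eqP) => [[<-] //|[iA xi]]; congr Some; apply: P_disj xj xi.
by apply: (iffP eqP) => // -[iA xi]; have := no i; rewrite /= iA xi.
Qed.

(** The number of users of [v] depends only on the cuts strictly below [v], so defining [O] by its
    own congestion is not circular. *)
Lemma exists_overcongested : exists O : {set T},
  {in O, forall v, (12 * delta * D%:R <= #|users O v|%:R)%R} /\
  {in V, forall v, v != root -> v \notin O ->
     (#|users O v|%:R <= 12 * delta * D%:R)%R}.
Proof.
(* The root has no tree edge above it and is never cut. *)
pose F O v := (v != root) && (12 * delta * D%:R <= #|users O v|%:R)%R.
have [|O [OV OP]] := bottom_up_fixpoint d_le (F := F).
  move=> O1 O2 v vV O12; rewrite /F; congr (_ && (_ <= #|pred_of_set _|%:R)%R).
  apply/setP=> i; apply/usersP/usersP => -[iA [u uP uv]]; split=> //; exists u => //;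
    have uV := PV iA uP; apply: (fconnect_climb_local parP) uv => //.
  by move=> w wV /O12 ->.
have VO v : v \in O -> v \in V by apply/subsetP.
exists O; split=> v.
  by move=> vO; have := OP _ (VO _ vO); rewrite vO => /esym/andP[].
by move=> vV vr; rewrite OP // /F vr /= -ltNge => /ltW.
Qed.

(** * Counting incidences of parts and cut edges through sampled minors *)

Variable O : {set T}.

Let topV u : u \in V -> top O u \in V.
Proof. exact: (iter_climbV parP). Qed.

Definition incidences : {set T * I} :=
  [set b | (b.1 \in O) && (b.2 \in users O b.1)].

(* An incidence (v, i) with v in P i yields no edge of the minor; as the parts
   are disjoint, there is at most one for each v in O. *)
Definition proper_incidences : {set T * I} :=
  [set b in incidences | b.1 \notin P b.2].

(* Minimizing d over the vertices of P b.2 that climb to b.1 selects the last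
   vertex of P b.2 on such a climb. *)
Lemma attachment b : b \in proper_incidences -> exists w,
  [/\ w \in P b.2, top O w = b.1, step O w != w &
      forall l, iter l.+1 (step O) w \notin P b.2].
Proof.
case: b => v i; rewrite !inE /= -!andbA => /and4P[vO iA /exists_inP[u0 u0P u0v] viP].
have inV u : u \in P i -> u \in V by exact: PV.
have fixv : step O v = v by apply: climb_id.
have u0top : top O u0 = v by apply/(climb_topP parP d_le (inV _ u0P) fixv).
have Q0 : (u0 \in P i) && (top O u0 == v) by rewrite u0P u0top eqxx.
case: (@arg_minnP _ u0 (fun u => (u \in P i) && (top O u == v)) d Q0) => w.
case/andP=> wP /eqP wtop wmin; have wV := inV _ wP.
have ne : step O w != w.
  by apply: contraNneq viP => fw; rewrite -wtop climb_top_id.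
exists w; split=> // l; apply/negP => lP.
have := wmin (iter l.+1 (step O) w).
rewrite lP (climb_top_iter parP d_le) // wtop eqxx => /(_ isT).
rewrite leqNgt iterSr; case/negP; apply: leq_ltn_trans (climb_lt parP wV ne).
by apply: (iter_climb_le parP); apply: (climbV parP).
Qed.

(** The parts of [A] met from the first step of the climb onwards. A climb in the graph is
    stationary after [D] steps, so [D] iterates suffice. Sampling must avoid these parts. *)
Definition crossed (w : T) : {set I} :=
  [set i | Some i \in [set owner (iter (val l).+1 (step O) w) | l : 'I_D]].

Lemma card_crossed w : #|crossed w| <= D.
Proof.
have Some_inj : injective (@Some I) by move=> i j [].
rewrite -(card_imset _ Some_inj) -[leqRHS]card_ord.
apply: leq_trans (leq_imset_card
  (fun l : 'I_D => owner (iter (val l).+1 (step O) w)) _).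
apply: subset_leq_card; apply/subsetP => x /imsetP[i iX ->].
by move: iX; rewrite inE.
Qed.

Lemma crossedP w i l : w \in V -> i \in A ->
  iter l.+1 (step O) w \in P i -> i \in crossed w.
Proof.
move=> wV iA lP; rewrite inE; apply/imsetP.
have own : owner (iter l.+1 (step O) w) = Some i by apply/eqP/ownerP.
have [ltl|gel] := ltnP l D; first by exists (Ordinal ltl).
(* Iterates beyond the [D]-th coincide with it, and the [D]-th one has index [D.-1]. *)
have ltD : D.-1 < D by rewrite prednK.
exists (Ordinal ltD) => //; rewrite -own [val _]/= prednK //; congr owner.
have -> : l.+1 = (l.+1 - D) + D by rewrite subnK // ltnW.
by rewrite iterD iter_fix //; apply: (climb_climb_top parP d_le).
Qed.

(** The minor has one branch set per sampled part, and for each cut vertex the vertices that climb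
    to it without meeting a sampled part. A counted incidence [b] gives the edge from [rep b] to the
    next vertex of its climb. *)
Lemma sample_edges_le (rep : T * I -> T) (S : {set I}) :
    {in proper_incidences, forall b,
      [/\ rep b \in P b.2, top O (rep b) = b.1, step O (rep b) != rep b &
          forall l, iter l.+1 (step O) (rep b) \notin P b.2]} ->
    S \subset A ->
  (#|[set b in proper_incidences | (b.2 \in S) && [disjoint S & crossed (rep b)]]|%:R
    <= delta * (#|S| + #|O|)%:R)%R.
Proof.
move=> repP /subsetP SA; set J := [set b in _ | _].
pose sampled x := if owner x is Some i then i \in S else false.
have sampledP x : reflect (exists2 i, i \in S & x \in P i) (sampled x).
  rewrite /sampled; apply: (iffP idP) => [|[i iS xi]].
    case E: (owner x) => [i|] // iS; exists i => //.
    by move/eqP/ownerP: E => [].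
  by have /ownerP/eqP -> : i \in A /\ x \in P i by split => //; apply: SA.
have [rho rhoP] : exists rho : I -> T, {in A, forall i, rho i \in P i}.
  exists (fun i => odflt root [pick x in P i]) => i iA.
  case: pickP => //= no; have [/set0Pn[x]] := P_conn iA.
  by rewrite inE => /andP[_]; rewrite no.
pose clear x := [forall w, fconnect (step O) x w ==> ~~ sampled w].
have clearP x : reflect (forall w, fconnect (step O) x w -> ~~ sampled w) (clear x).
  by apply: (iffP forallP) => c w; [move/(implyP (c w)) | apply/implyP/c].
have clear_climb x : clear x -> clear (step O x).
  move/clearP=> cx; apply/clearP => w cw; apply: cx.
  by apply: connect_trans cw; apply: fconnect1.
have clearN x : clear x -> ~~ sampled x by move/clearP; apply; apply: connect0.
(* Clear vertices whose climb ends outside [O], hence at the root, are deleted. The others are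
   represented by the end of their climb, and sampled parts by [rho]. *)
pose U := [set x in V | sampled x || (top O x \in O) && clear x].
pose r x := if sampled x then odflt root (omap rho (owner x)) else top O x.
have rS i x : i \in S -> x \in P i -> r x = rho i.
  move=> iS xi; rewrite /r; have -> : sampled x by apply/sampledP; exists i.
  by have /ownerP/eqP -> : i \in A /\ x \in P i by split => //; apply: SA.
have rC x : clear x -> r x = top O x by rewrite /r => /clearN/negPf ->.
have US i x : i \in S -> x \in P i -> x \in U.
  move=> iS xi; rewrite inE (PV (SA _ iS) xi).
  by have -> : sampled x by apply/sampledP; exists i.
have UC x : x \in V -> top O x \in O -> clear x -> x \in U.
  by move=> xV xO xc; rewrite inE xV xO xc orbT.
pose E b := [set rho b.2; b.1].
have JP b : b \in J -> [/\ b \in proper_incidences, b.2 \in S,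
    rep b \in V, clear (step O (rep b)) & ~~ sampled b.1].
  rewrite inE => /and3P[bB bS dis]; have [wP wtop ne out] := repP b bB.
  have wV := PV (SA _ bS) wP.
  have cl : clear (step O (rep b)).
    apply/clearP=> w /iter_findex; rewrite -iterSr.
    move: (findex _ _ _) => l lw; apply/sampledP => -[i iS wi].
    move: wi; rewrite -lw => /(crossedP wV (SA _ iS)) ix.
    by have := disjointFr dis iS; rewrite ix.
  split=> //; move/clearP: cl; apply; rewrite -wtop.
  rewrite -(climb_top_iter parP d_le O 1 wV) /=.
  exact: fconnect_iter.
(* [rho b.2] is sampled and [b.1] is not, so the unordered pair shows which end is which;
   disjointness of the parts then recovers [b.2] from [rho b.2]. *)
have Einj : {in J &, injective E}.
  move=> [v1 i1] [v2 i2] /JP[_ /= S1 _ _ n1] /JP[_ /= S2 _ _ n2]; rewrite /E /= => e.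
  have s1 : sampled (rho i1) by apply/sampledP; exists i1 => //; apply/rhoP/SA.
  have s2 : sampled (rho i2) by apply/sampledP; exists i2 => //; apply/rhoP/SA.
  have : v1 \in [set rho i2; v2] by rewrite -e set22.
  case/set2P=> [v1E|->]; first by rewrite v1E s2 in n1.
  have : rho i1 \in [set rho i2; v2] by rewrite -e set21.
  case/set2P=> [rE|rE]; last by rewrite -rE s1 in n2.
  congr (_, _); apply: (P_disj (SA _ S1) (SA _ S2) (rhoP _ (SA _ S1))).
  by rewrite rE; apply/rhoP/SA.
rewrite -(card_in_imset Einj).
apply: (@le_trans _ _ (delta * #|r @: U|%:R)%R); last first.
  rewrite ler_wpM2l ?(ltW delta_gt0) // ler_nat.
  apply: (@leq_trans #|(rho @: S) :|: O|).
    apply: subset_leq_card; apply/subsetP => _ /imsetP[x + ->].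
    rewrite !inE => /andP[xV /orP[/sampledP[i iS xi]|/andP[xO xc]]].
      by rewrite (rS i) // imset_f.
    by rewrite rC // xO orbT.
  by rewrite cardsU (leq_trans (leq_subr _ _)) // leq_add2r leq_imset_card.
apply: (model_edges_le density (r := r) (U := U)).
- by apply/subsetP=> x; rewrite inE => /andP[].
- move=> x; rewrite inE => /andP[xV /orP[/sampledP[i iS xi]|/andP[xO xc]]].
    have iA := SA _ iS; have [_ conn] := P_conn iA.
    have inI y : y \in P i -> y \in verts (induced_subgraph G (P i)).
      by move=> yi; rewrite inE (PV iA yi).
    rewrite (rS i) //.
    apply: connect_sub (conn _ _ (inI _ xi) (inI _ (rhoP _ iA))) => a b.
    rewrite gadj_mkgraph !inE => /and4P[ab /andP[_ ai] /andP[_ bi] _].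
    by apply: connect1; rewrite /= /gadj ab !(US i) // !(rS i) /=.
  (* Induction on the number of climbing steps, while the relation keeps the [r] of the full
     climb. *)
  rewrite rC // /climb_top; set e := (X in connect X).
  move: (D in iter D) => n.
  elim: n x xV xO xc => [|n IHn] x xV xO xc; first exact: connect0.
  have topE : top O (step O x) = top O x := climb_top_iter parP d_le O 1 xV.
  rewrite iterSr; apply: connect_trans (IHn _ _ _ _); last 1 first.
  + exact: clear_climb.
  + have [-> //|ne] := eqVneq (step O x) x.
    apply: connect1; rewrite /e /= climb_adj //.
    rewrite !UC ?topE ?(climbV parP) ?clear_climb //.
    by rewrite !rC ?topE ?clear_climb ?eqxx.
  + exact: (climbV parP).
  + by rewrite topE.
move=> _ /imsetP[[v i] bJ ->].
have [bB /= iS wV cl nv] := JP _ bJ; have [/= wP wtop ne _] := repP _ bB.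
have topE := climb_top_iter parP d_le O 1 wV; rewrite /= wtop in topE.
have vO : v \in O by move: bB; rewrite !inE -andbA => /and3P[].
exists (rep (v, i)), (step O (rep (v, i))).
rewrite climb_adj // (US i) // UC ?(climbV parP) ?topE //.
rewrite (rS i) // rC // topE /E /=; split=> //.
apply: contraNneq nv => <-; apply/sampledP; exists i => //; exact/rhoP/SA.
Qed.

(** Instance of the sampling bound: if [b.2] is kept and [crossed (rep b)] is avoided, the climb
    from [rep b] to the cut is free of sampled parts after its start. *)
Lemma card_proper_incidences :
  (#|proper_incidences|%:R <= 2 * delta * #|A|%:R + 4 * D%:R * delta * #|O|%:R)%R.
Proof.
have [rep repP] : exists rep : T * I -> T, {in proper_incidences, forall b,
      [/\ rep b \in P b.2, top O (rep b) = b.1, step O (rep b) != rep b &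
          forall l, iter l.+1 (step O) (rep b) \notin P b.2]}.
  (* Through [crossed], the condition on all later iterates becomes boolean, so [pick] can choose
     [rep b]. *)
  pose good b w := [&& w \in P b.2, top O w == b.1, step O w != w &
    b.2 \notin crossed w].
  exists (fun b => odflt root [pick w | good b w]) => b bB.
  have bA : b.2 \in A by move: bB; rewrite !inE -!andbA => /and4P[].
  case: pickP => [w /and4P[wP /eqP wtop ne nc]|no] /=.
    split=> // l; apply: contra nc; apply: crossedP => //; exact: PV wP.
  have [w [wP wtop ne out]] := attachment bB.
  have := no w; rewrite /good wP wtop ne eqxx /= => /negbFE.
  rewrite inE => /imsetP[l _ /esym/eqP/ownerP[_]].
  by move/negP: (out l).
apply: (sampling_bound (idx := snd) (X := fun b => crossed (rep b))) => //.
  move=> b bB; rewrite card_crossed; split=> //.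
    by move: bB; rewrite !inE -!andbA => /and4P[].
  have [_ _ _ out] := repP b bB; rewrite inE.
  apply/imsetP=> -[l _ /esym/eqP/ownerP[_]].
  by move/negP: (out l).
by move=> S SA; apply: sample_edges_le.
Qed.

Hypothesis O_users :
  {in O, forall v, (12 * delta * D%:R <= #|users O v|%:R)%R}.

Lemma card_incidences_sum : #|incidences| = \sum_(v in O) #|users O v|.
Proof.
rewrite -sum1_card (eq_bigl (fun b => (b.1 \in O) && (b.2 \in users O b.1))).
  rewrite -(pair_big_dep (mem O) (fun v i => i \in users O v) (fun _ _ => 1)) /=.
  by apply: eq_bigr => v _; rewrite sum1_card.
by move=> b; rewrite inE.
Qed.

(** Write [J] for the number of incidences and [o] for [#|O|]. Then
    [J <= 2 delta |A| + 4 delta D o + o], and [o <= 2 delta D o], so the last two terms add up to at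
    most [6 delta D o]. The threshold [12 delta D] makes this at most [J / 2]. *)
Lemma card_incidences : (#|incidences|%:R <= 4 * delta * #|A|%:R)%R.
Proof.
have leO : #|incidences| <= #|proper_incidences| + #|O|.
  have -> : #|incidences| =
      #|proper_incidences| + #|[set b in incidences | b.1 \in P b.2]|.
    rewrite -(cardsID [set b : T * I | b.1 \in P b.2] incidences) addnC.
    congr (_ + _); apply: eq_card => b; rewrite !inE //.
    by rewrite andbC.
  rewrite leq_add2l -(card_in_imset (f := fst)).
    by apply: subset_leq_card; apply/subsetP => _ /imsetP[b + ->];
      rewrite !inE => /andP[/andP[]].
  move=> [v1 i1] [v2 i2]; rewrite !inE /= -!andbA.
  move=> /and4P[_ A1 _ P1] /and4P[_ A2 _ P2] e; rewrite -e in P2 *.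
  by congr (_, _); apply: P_disj P1 P2.
have geO : (12 * delta * D%:R * #|O|%:R <= #|incidences|%:R)%R.
  rewrite card_incidences_sum natr_sum mulr_natr -sumr_const.
  by apply: ler_sum => v; apply: O_users.
have := card_proper_incidences.
move: leO; rewrite -(ler_nat R) natrD => leO leP.
have D1 : (1 <= D%:R :> R)%R by rewrite ler1n.
have O0 : (0 <= #|O|%:R :> R)%R by rewrite ler0n.
have O1 : (#|O|%:R <= 2 * delta * D%:R * #|O|%:R)%R.
  rewrite -[leLHS]mul1r ler_wpM2r //; move: delta_ge D1; nra.
lra.
Qed.

(** * Parts of low degree and their shortcuts *)

Definition degree i := #|[set v in O | i \in users O v]|.

Lemma sum_degree : \sum_(i in A) degree i = #|incidences|.
Proof.
rewrite card_incidences_sum.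
rewrite (eq_bigr (fun v => \sum_(i in A) (i \in users O v : nat))); last first.
  move=> v _; rewrite -sum1_card [LHS]big_mkcond [RHS]big_mkcond /=.
  by apply: eq_bigr => i _; rewrite inE; case: (i \in A).
rewrite exchange_big /=; apply: eq_bigr => i _.
rewrite /degree -sum1_card [LHS]big_mkcond [RHS]big_mkcond /=.
by apply: eq_bigr => v _; rewrite inE; case: (v \in O) => //=; case: (i \in users O v).
Qed.

Definition low_degree : {set I} := [set i in A | ((degree i)%:R <= 8 * delta)%R].

(** Markov's inequality: the degrees average at most [4 delta], so at most half of them exceed
    [8 delta]. *)
Lemma card_low_degree : (#|A :\: low_degree|).*2 <= #|A|.
Proof.
have : (8 * delta * #|A :\: low_degree|%:R <= 4 * delta * #|A|%:R)%R.
  apply: le_trans card_incidences; rewrite -sum_degree (big_setID low_degree) /=.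
  rewrite natrD mulr_natr -sumr_const ler_wpDl ?ler0n // natr_sum.
  apply: ler_sum => i; rewrite !inE => /andP[+ iA].
  by rewrite iA /= -ltNge => /ltW.
rewrite -(ler_nat R) -muln2 natrM => le; move: delta_gt0 le => d0 le.
rewrite -(ler_pM2l (_ : 0 < 4 * delta)%R); last by move: d0; lra.
by apply: le_trans le; rewrite le_eqVlt; apply/orP; left; apply/eqP; ring.
Qed.

Definition reached i : {set T} := [set w | [exists u in P i, fconnect (step O) u w]].

(** The shortcut of part [i]: the uncut tree edges on its climbs, each given by its lower
    endpoint. *)
Definition ancestors i : graph T :=
  mkgraph (reached i)
    [set [set w; par w] | w in reached i & (w != root) && (w \notin O)].

Lemma reachedP i w :
  reflect (exists2 u, u \in P i & fconnect (step O) u w) (w \in reached i).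
Proof. by rewrite inE; apply: exists_inP. Qed.

Lemma reachedV i w : i \in A -> w \in reached i -> w \in V.
Proof.
by move=> iA /reachedP[u uP]; apply: (fconnect_climbV parP); apply: PV uP.
Qed.

Lemma reached_climb i w : w \in reached i -> step O w \in reached i.
Proof.
move=> /reachedP[u uP uw]; apply/reachedP; exists u => //.
by apply: connect_trans uw _; apply: fconnect1.
Qed.

Lemma P_reached i w : w \in P i -> w \in reached i.
Proof. by move=> wP; apply/reachedP; exists w; rewrite // connect0. Qed.

Lemma reached_users i v : i \in A -> v \in reached i -> i \in users O v.
Proof. by move=> iA /reachedP[u uP uv]; apply/usersP; split=> //; exists u. Qed.

Lemma ancestors_subgraph i : i \in A -> subgraph (ancestors i) G.
Proof.
move=> iA; split; first by apply/subsetP => w; apply: reachedV.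
apply/subsetP => f; rewrite edges_mkgraph => /and3P[/imsetP[w + ->] _ _].
by rewrite inE => /and3P[wi wr _]; apply: par_adj => //; apply: reachedV wi.
Qed.

(** A tree edge determines its lower endpoint [w], so every part whose shortcut contains it is a
    user of the uncut vertex [w]. *)
Lemma ancestors_congestion (B : {set I}) f : B \subset A ->
    {in V, forall v, v != root -> v \notin O ->
        (#|users O v|%:R <= 12 * delta * D%:R)%R} ->
  (#|[set i in B | f \in edges (ancestors i)]|%:R <= 12 * delta * D%:R)%R.
Proof.
move=> /subsetP BA few.
have [->|[i]] := set_0Vmem [set i in B | f \in edges (ancestors i)].
  by rewrite cards0 !mulr_ge0 ?ler0n // ltW.
rewrite inE => /andP[/BA iA]; rewrite edges_mkgraph => /and3P[/imsetP[w + fE] _ _].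
rewrite inE => /and3P[wi wr wO]; have wV := reachedV iA wi.
apply: le_trans (few w wV wr wO); rewrite ler_nat; apply: subset_leq_card.
apply/subsetP => j; rewrite inE edges_mkgraph => /and4P[/BA jA /imsetP[w' + fE'] _ _].
rewrite inE => /and3P[wj wr' _]; have wV' := reachedV jA wj.
apply: reached_users => //; have [-> //|ne] := eqVneq w w'.
(* Otherwise [w] and [w'] would be parents of each other, against the decrease of [d]. *)
have e : [set w; par w] = [set w'; par w'] by rewrite -fE.
have : w \in [set w'; par w'] by rewrite -e set21.
have : w' \in [set w; par w] by rewrite e set21.
rewrite !inE ![w' == w]eq_sym (negPf ne) /= => /eqP w'E /eqP wE.
have := par_lt wV' wr'; have := par_lt wV wr.
by rewrite -w'E -wE => /ltn_trans lt /lt; rewrite ltnn.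
Qed.

(** The hubs are the ends of the climbs: the root and the cut vertices that [i] uses, at most
    [1 + 8 delta <= 10 delta] in number. Each contributes [2 D + 1 <= 3 D], whence the constant
    30. *)
Lemma ancestors_walk_le i : i \in low_degree ->
  exists2 N : nat, (N%:R <= 30 * delta * D%:R)%R &
    let K := gunion (induced_subgraph G (P i)) (ancestors i) in
    {in verts K &, forall x y, walk_le K N x y}.
Proof.
rewrite inE => /andP[iA deg]; set K := gunion _ _.
have KE : verts K = reached i.
  rewrite !verts_mkgraph; apply/setUidPr/subsetP => x.
  by rewrite inE => /andP[_]; apply: P_reached.
have gadjK x y : gadj K x y =
    [&& [set x; y] \in edges (induced_subgraph G (P i)) :|: edges (ancestors i),
        x \in reached i, y \in reached i & x != y].
  by rewrite -KE; apply: gadj_mkgraph.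
have climbK x : x \in reached i -> step O x != x -> gadj K x (step O x).
  move=> xi ne; have [_ _ xc] := gadjW (climb_adj (reachedV iA xi) ne).
  rewrite gadjK xi reached_climb // xc.
  have : [set x; step O x] \in edges (ancestors i).
    rewrite edges_mkgraph subUset !sub1set xi reached_climb // cards2 xc !andbT.
    move: ne; rewrite /climb; case: ifP => [|/negbT]; first by rewrite eqxx.
    rewrite negb_or => xO _; apply/imsetP; exists x; rewrite ?inE ?xO ?andbT //.
    by move: xi; rewrite inE.
  by rewrite in_setU => ->; rewrite orbT.
have iterK n x : x \in reached i -> walk_le K n x (iter n (step O) x).
  elim: n x => [|n IHn] x xi; first exact: walk_le0.
  rewrite iterSr -add1n; apply: walk_le_trans (IHn _ (reached_climb xi)).
  have [->|/(climbK _ xi)] := eqVneq (step O x) x; first exact: walk_le0.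
  exact: walk_le1.
have walk_leK n x y : walk_le K n x y -> connect (gadj K) x y.
  by move=> [p [xp <- _]]; apply/connectP; exists p.
pose Q := root |: [set v in O | i \in users O v].
exists (#|Q| * D.*2.+1).
  have D1 : (1 <= D%:R :> R)%R by rewrite ler1n.
  have Q1 : (#|Q|%:R <= 1 + 8 * delta)%R.
    apply: (@le_trans _ _ (1 + degree i)%:R%R); last by rewrite natrD lerD2l.
    by rewrite ler_nat cardsU1 leq_add2r leq_b1.
  rewrite natrM -addn1 natrD -muln2 natrM.
  apply: (@le_trans _ _ ((10 * delta) * (3 * D%:R))%R); last first.
    by rewrite le_eqVlt; apply/orP; left; apply/eqP; ring.
  apply: ler_pM; rewrite ?addr_ge0 ?mulr_ge0 ?ler0n //; move: delta_ge; lra.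
apply: (@hub_walk_le _ K (top O)) => [x|]; rewrite KE.
  move=> xi; split; last exact: iterK.
  have xV := reachedV iA xi.
  have [->|tO] := climb_stop parP (topV xV) (climb_climb_top parP d_le O xV).
    by rewrite !inE eqxx.
  rewrite /Q in_setU1 in_set tO reached_users ?orbT //.
  by rewrite /climb_top; elim: (D) => //= n; apply: reached_climb.
have sK : connect_sym (gadj K) by apply: sym_connect_sym; apply: gadj_sym.
(* Connectivity of [K]: a climb joins every reached vertex to [P i], which is connected. *)
have toP x : x \in reached i -> exists2 u, u \in P i & connect (gadj K) u x.
  move=> /reachedP[u uP /iter_findex <-]; exists u => //.
  by apply: walk_leK (iterK _ _ (P_reached uP)).
move=> x y /toP[u uP ux] /toP[v vP vy]; rewrite sK in ux.
apply: connect_trans ux _; apply: connect_trans vy.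
have [_ conn] := P_conn iA.
have inI w : w \in P i -> w \in verts (induced_subgraph G (P i)).
  by move=> wP; rewrite inE (PV iA wP).
apply: connect_sub (conn _ _ (inI _ uP) (inI _ vP)) => a b ab; apply: connect1.
have [aI bI ne] := gadjW ab.
move: aI bI; rewrite !in_setI => /andP[_ aP] /andP[_ bP].
by rewrite gadjK in_setU -/(gadj _ a b) ab !P_reached.
Qed.

End Round.

(** * Assembling the rounds *)

(** [d v] is the length of a shortest walk from the root. The vertex before [v] on such a walk is a
    neighbour of smaller depth, so a parent can be picked. *)
Lemma exists_bfs_tree (T : finType) (G : graph T) (root : T) (D : nat) :
    {in verts G, forall v, walk_le G D root v} ->
  exists (par : T -> T) (d : T -> nat),
    [/\ {in verts G, forall v, v != root -> gadj G v (par v)},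
        {in verts G, forall v, v != root -> d (par v) < d v} &
        {in verts G, forall v, d v <= D}].
Proof.
move=> near.
pose layer v n := [exists p : n.-tuple T, path (gadj G) root p && (last root p == v)].
have layerP p v : path (gadj G) root p -> last root p = v -> layer v (size p).
  by move=> rp pv; apply/existsP; exists (in_tuple p); rewrite /= rp pv /=.
pose d v := find (layer v) (iota 0 D.+1).
have has_layer v : v \in verts G -> has (layer v) (iota 0 D.+1).
  move=> /near[p [rp pv sp]]; apply/hasP; exists (size p); last exact: layerP.
  by rewrite mem_iota ltnS.
have d_le v : v \in verts G -> d v <= D.
  by move=> /has_layer; rewrite has_find size_iota ltnS.
have d_min v n : n <= D -> layer v n -> d v <= n.
  move=> nD vn; rewrite leqNgt; apply/negP => /(before_find 0).
  by rewrite nth_iota ?ltnS // add0n vn.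
have prev v : v \in verts G -> v != root -> exists u, gadj G v u && (d u < d v).
  move=> vV vr; have := nth_find 0 (has_layer v vV).
  rewrite -/(d v) nth_iota ?ltnS ?d_le // add0n => /existsP[p /andP[rp /eqP pv]].
  have := d_le v vV; rewrite -(size_tuple p).
  case/lastP: (tval p) rp pv => [_ /= E|q x]; first by rewrite E eqxx in vr.
  rewrite rcons_path last_rcons size_rcons => /andP[rq qx] xv qD; rewrite xv in qx.
  exists (last root q); rewrite gadj_sym qx ltnS.
  by apply: d_min (layerP _ _ rq erefl); apply: ltnW.
exists (fun v => odflt root [pick u | gadj G v u && (d u < d v)]), d; split=> //
  v vV vr; case: pickP => [u /andP[] //|no] /=;
  by have [u] := prev v vV vr; rewrite no.
Qed.

(** A single edge with its two endpoints is a minor of density 1/2. *)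
Lemma density_ge_half (R : numDomainType) (T : finType) (G : graph T) (delta : R) x y :
    (forall H, minor H G -> (#|edges H|%:R <= delta * #|verts H|%:R)%R) ->
    gadj G x y ->
  (1 <= 2 * delta)%R.
Proof.
move=> dens xy; have [xV yV ne] := gadjW xy.
have := @model_edges_le _ _ _ _ [set x; y] id [set [set x; y]] dens.
rewrite imset_id cards1 cards2 ne mulrC; apply.
- by rewrite subUset !sub1set xV yV.
- by move=> v _; apply: connect0.
- by move=> f /set1P->; exists x, y; rewrite set21 set22.
Qed.

(** Choosing one vertex in each part is injective; the resulting bound on [k] lets [log n] control
    the number of rounds. *)
Lemma connected_partitionW (T : finType) (G : graph T) k (P : 'I_k -> {set T}) :
    connected_partition G P ->
  [/\ forall i, P i \subset verts G,
      forall i j x, x \in P i -> x \in P j -> i = j &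
      k <= #|verts G|].
Proof.
move=> [Pinj /and3P[/eqP cov /trivIsetP triv _] conn].
have sub i : P i \subset verts G.
  by rewrite -cov; apply: bigcup_sup (imset_f _ _).
have disj i j x : x \in P i -> x \in P j -> i = j.
  move=> xi xj; apply/eqP; apply: contraT => ij.
  have := triv (P i) (P j) (imset_f _ _) (imset_f _ _) _.
  rewrite (inj_eq Pinj) ij => /(_ isT isT isT) dis.
  by have := disjointFr dis xi; rewrite xj.
split=> //.
have ne i : exists x, x \in P i.
  have [/set0Pn[x]] := conn i.
  by rewrite inE => /andP[_ xi]; exists x.
pose rho i := xchoose (ne i).
have rhoP i : rho i \in P i := xchooseP (ne i).
have rho_inj : injective rho.
  by move=> i j e; apply: disj (rhoP i) _; rewrite e.
rewrite -[k]card_ord -cardsT -(card_imset _ rho_inj).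
by apply: subset_leq_card; apply/subsetP => _ /imsetP[i _ ->]; apply: subsetP (rhoP i).
Qed.

Section Shortcuts.
Variables (R : realFieldType) (T I : finType) (G : graph T) (delta : R).
Variables (D : nat) (P : I -> {set T}).
Hypothesis near : {in verts G &, forall x y, walk_le G D x y}.
Hypothesis card_gt1 : 1 < #|verts G|.
Hypothesis density : forall H, minor H G -> (#|edges H|%:R <= delta * #|verts H|%:R)%R.
Hypothesis P_sub : forall i, P i \subset verts G.
Hypothesis P_conn : forall i, gconnected (induced_subgraph G (P i)).
Hypothesis P_disj : forall i j x, x \in P i -> x \in P j -> i = j.

Definition good_shortcut i (H : graph T) : Prop :=
  subgraph H G /\ exists2 N : nat, (N%:R <= 30 * delta * D%:R)%R &
    let K := gunion (induced_subgraph G (P i)) H in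
    {in verts K &, forall x y, walk_le K N x y}.

(** Two distinct vertices are joined by a nonempty walk of length at most [D], and its first edge
    bounds [delta] from below. *)
Lemma D_pos_delta_ge : 0 < D /\ (1 <= 2 * delta)%R.
Proof.
have /card_gt1P[x [y [xV yV ne]]] := card_gt1.
have [[|z p] [xp pE sp]] := near xV yV; first by rewrite -pE eqxx in ne.
split; first by apply: leq_trans sp.
by move: xp => /= /andP[xz _]; apply: density_ge_half xz.
Qed.

Lemma half_shortcuts (A : {set I}) : exists (B : {set I}) (H : I -> graph T),
  [/\ B \subset A, (#|A :\: B|).*2 <= #|A|,
      {in B, forall i, good_shortcut i (H i)} &
      forall f, (#|[set i in B | f \in edges (H i)]|%:R <= 12 * delta * D%:R)%R].
Proof.
have [D0 delta_ge] := D_pos_delta_ge.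
have /card_gt0P[root rV] : 0 < #|verts G| by apply: ltnW.
have [par [d [adj lt d_le]]] := exists_bfs_tree (fun v => near rV (y := v)).
have PA : {in A, forall i, P i \subset verts G} by [].
have PC : {in A, forall i, gconnected (induced_subgraph G (P i))} by [].
have PD : {in A &, forall i j x, x \in P i -> x \in P j -> i = j}.
  by move=> i j _ _ x; apply: P_disj.
have [O [many few]] := exists_overcongested delta adj lt d_le PA.
exists (low_degree delta root par P A O), (ancestors root par P O); split.
- by apply/subsetP => i; rewrite inE => /andP[].
- exact: (card_low_degree adj lt d_le D0 delta_ge density PA PC PD many).
- move=> i iB; split; last exact: (ancestors_walk_le adj lt d_le D0 delta_ge PA PC iB).
  by apply: (ancestors_subgraph adj lt PA); move: iB; rewrite inE => /andP[].
move=> f; apply: (ancestors_congestion adj lt delta_ge PA) few.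
by apply/subsetP => i; rewrite inE => /andP[].
Qed.

(** A round leaves at most half of the parts, so [L] rounds exhaust fewer than [2 ^ L] of them, each
    adding at most [12 delta D] to the congestion. *)
Lemma iterated_shortcuts (L : nat) (A : {set I}) : #|A| < 2 ^ L ->
  exists H : I -> graph T, {in A, forall i, good_shortcut i (H i)} /\
    forall f, (#|[set i in A | f \in edges (H i)]|%:R <= 12 * delta * D%:R * L%:R)%R.
Proof.
elim: L A => [|L IHL] A ltA.
  have -> : A = set0 by apply/eqP; rewrite -cards_eq0 -leqn0 -ltnS.
  exists (fun=> G); split=> [i|f]; first by rewrite inE.
  rewrite mulr0 lern0 cards_eq0; apply/eqP/setP => i.
  by rewrite !inE.
have [B [H1 [BA ltB cut1 cong1]]] := half_shortcuts A.
have [|H2 [cut2 cong2]] := IHL (A :\: B).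
  by move: ltB ltA; rewrite expnS; lia.
exists (fun i => if i \in B then H1 i else H2 i); split=> [i iA|f].
  case: ifP => [/cut1 //|iB]; apply: cut2.
  by rewrite inE iB iA.
rewrite -(addn1 L) natrD mulrDr mulr1 addrC.
apply: le_trans (lerD (cong1 f) (cong2 f)); rewrite -natrD ler_nat.
apply: leq_trans (leq_card_setU _ _); apply: subset_leq_card.
apply/subsetP => i; rewrite !inE => /andP[iA].
by case: ifP => iB ->; rewrite ?iA ?orbT.
Qed.

End Shortcuts.

(* Distances in the extended reals and the logarithmic bound *)
From mathcomp Require Import all_classical all_reals all_analysis.

Local Open Scope ring_scope.

Section Distances.
Variables (R : realType) (T : finType).
Implicit Types (G K : graph T).

Lemma walk_le_of_dist G (n : nat) x y :
  (dist R G x y <= n%:R%:E)%E -> walk_le G n x y.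
Proof.
(* A strict upper bound on the infimum yields an actual walk; its length is an integer below
   [n + 1], hence at most [n]. *)
move=> le; have : (dist R G x y < n.+1%:R%:E)%E.
  by apply: le_lt_trans le _; rewrite lte_fin ltr_nat.
case/ereal_inf_lt => _ [p [xp py] <-]; rewrite lte_fin ltr_nat => sp.
by exists p.
Qed.

Lemma dist_le G (n : nat) x y :
  walk_le G n x y -> (dist R G x y <= n%:R%:E)%E.
Proof.
move=> [p [xp py sp]]; apply: (@le_trans _ _ (size p)%:R%:E).
  by apply: ereal_inf_lbound; exists p.
by rewrite lee_fin ler_nat.
Qed.

Lemma walk_le_of_diameter G (D : nat) : diameter R G = D%:R%:E ->
  {in verts G &, forall x y, walk_le G D x y}.
Proof.
move=> diam x y xV yV; apply: walk_le_of_dist; rewrite -diam.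
apply: le_trans (le_bigmax_cond _ _ xV).
exact: (le_bigmax_cond _ _ yV).
Qed.

(** [0 <= c] accounts for the value 0 from which both maxima start. *)
Lemma diameter_le G (c : R) : 0 <= c ->
    (exists2 N : nat, N%:R <= c & {in verts G &, forall x y, walk_le G N x y}) ->
  (diameter R G <= c%:E)%E.
Proof.
move=> c0 [N Nc GN]; apply: bigmax_le => [|x xV]; first by rewrite lee_fin.
apply: bigmax_le => [|y yV]; first by rewrite lee_fin.
by apply: le_trans (dist_le (GN x y xV yV)) _; rewrite lee_fin.
Qed.

Lemma minor_density_ge0 G : 0 <= minor_density R G.
Proof. exact: bigmax_ge_id. Qed.

Lemma edges_minor_le G H : minor H G ->
  #|edges H|%:R <= minor_density R G * #|verts H|%:R.
Proof.
(* The ratio can be multiplied out only when there are vertices; without vertices there are no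
   edges. *)
move=> HG; have [V0|V0] := posnP #|verts H|; last first.
  rewrite -ler_pdivrMr ?ltr0n //.
  rewrite /minor_density.
  exact: (le_bigmax_cond 0 (fun K : graph T => #|edges K|%:R / #|verts K|%:R : R)).
rewrite V0 mulr0 lern0 cards_eq0; apply/eqP/setP => f; rewrite inE.
apply/negbTE/negP => /edge_sub[/subset_leq_card].
by rewrite V0 leqn0 => /eqP ->.
Qed.

End Distances.

Theorem theorem1p2 (R : realType) :
  exists C : R, 0 < C /\
  forall (T : finType) (G : graph T) (n D : nat) (delta : R),
    gconnected G ->
    #|verts G| = n ->
    diameter R G = (D%:R)%:E ->
    minor_density R G = delta ->
  forall (k : nat) (P : 'I_k -> {set T}),
    connected_partition G P ->
  exists H : 'I_k -> graph T,
    [/\ shortcut G H,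
        (dilation R G P H <= (C * delta * D%:R)%:E)%E &
        (congestion G H)%:R <= C * delta * D%:R * ln n%:R].
Proof.
have ln2 : 0 < ln 2%:R :> R by rewrite ln_gt0 // ltr1n.
have C2 : 0 < 24 / ln 2%:R :> R by rewrite divr_gt0.
(* The first summand serves the dilation, the second the congestion. *)
exists (30 + 24 / ln 2%:R); split; first by rewrite addr_gt0.
set C := _ + _; move=> T G n D delta conn cardV diam dens k P partP.
have delta0 : 0 <= delta by rewrite -dens minor_density_ge0.
have dD0 : 0 <= delta * D%:R by rewrite mulr_ge0.
have C0 : 0 <= C * delta * D%:R by rewrite -mulrA mulr_ge0 // addr_ge0 // ltW.
have near := walk_le_of_diameter diam.
have density H : minor H G -> #|edges H|%:R <= delta * #|verts H|%:R.
  by rewrite -dens; apply: edges_minor_le.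
have [P_sub P_disj k_le] := connected_partitionW partP.
have P_conn i : gconnected (induced_subgraph G (P i)) by case: partP.
(* For a single vertex [ln n] is 0, so the congestion has to vanish: empty shortcuts do. *)
have [n1|n_gt1] := leqP n 1%N.
  exists (fun=> mkgraph finset.set0 finset.set0); split.
  - move=> i; split; first exact: finset.sub0set.
    by apply/fintype.subsetP => f; rewrite edges_mkgraph finset.in_set0.
  - apply: bigmax_le => [|i _]; first by rewrite lee_fin.
    apply: diameter_le => //; exists 0%N => //.
    move=> x y; rewrite !verts_mkgraph finset.setU0 !finset.in_setI.
    move=> /andP[xV _] /andP[yV _].
    have /fintype.card_le1_eqP/(_ x y xV yV) -> : (#|verts G| <= 1)%N by rewrite cardV.
    exact: walk_le0.
  - have -> : congestion G (fun=> mkgraph finset.set0 finset.set0) = 0%N.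
      move=> *; apply/eqP; rewrite -leqn0; apply/bigmax_leqP => f.
      case/edge_sub => /subset_leq_card; rewrite cardV => /leq_trans/(_ n1) + f2.
      by rewrite f2.
    by rewrite mulr_ge0 ?ln_ge0 // ler1n -cardV card_gt0 (proj1 conn).
have V_gt1 : (1 < #|verts G|)%N by rewrite cardV.
(* The number of rounds is the integer part of [log2 k], plus one. *)
have ltk : (#|[set: 'I_k]%SET| < 2 ^ (trunc_log 2 k).+1)%N.
  by rewrite cardsT card_ord trunc_log_ltn.
have [H [cut cong]] :=
  iterated_shortcuts near V_gt1 density P_sub P_conn P_disj ltk.
have in_all (i : 'I_k) : i \in [set: 'I_k]%SET by rewrite finset.in_setT.
have C30 : 30 * delta * D%:R <= C * delta * D%:R.
  by rewrite -!mulrA ler_wpM2r // lerDl ltW.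
have lnn : ln 2%:R <= ln n%:R :> R by rewrite ler_ln ?posrE ?ltr0n ?ler_nat // ltnW.
exists H; split.
- by move=> i; case: (cut i (in_all i)).
- apply: bigmax_le => [|i _]; first by rewrite lee_fin.
  apply: diameter_le => //.
  have [_ [N NC KN]] := cut i (in_all i).
  by exists N; first exact: le_trans NC C30.
have cong_le : (congestion G H)%:R <= 12 * delta * D%:R * (trunc_log 2 k).+1%:R.
  apply: (big_ind (fun m : nat => m%:R <= 12 * delta * D%:R * (trunc_log 2 k).+1%:R)).
  - by rewrite -mulrA !mulr_ge0.
  - by move=> a b; rewrite /maxn; case: ifP.
  - move=> f _; apply: le_trans (cong f); rewrite ler_nat subset_leq_card //.
    by apply/fintype.subsetP => i; rewrite !inE.
apply: le_trans cong_le _.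
have logk : (trunc_log 2 k)%:R * ln 2%:R <= ln n%:R :> R.
  have [->|k0] := posnP k; first by rewrite trunc_log0 mul0r (le_trans _ lnn) // ltW.
  rewrite mulrC mulr_natr -lnXn ?ltr0n // ler_ln ?posrE ?exprn_gt0 ?ltr0n //;
    last exact: ltnW.
  by rewrite -natrX ler_nat (leq_trans (trunc_logP _ _)) // -cardV.
(* As [n >= 2], the extra round is absorbed: [log2 n + 1 <= 2 log2 n]. This factor 2 turns 12 into
   24. *)
have L2 : (trunc_log 2 k).+1%:R <= 2 / ln 2%:R * ln n%:R :> R.
  rewrite mulrAC ler_pdivlMr // -natr1 mulrDl mul1r.
  by move: logk lnn; lra.
apply: (@le_trans _ _ (12 * delta * D%:R * (2 / ln 2%:R * ln n%:R))).
  by rewrite ler_wpM2l // -mulrA mulr_ge0.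
have -> : 12 * delta * D%:R * (2 / ln 2%:R * ln n%:R) =
  24 / ln 2%:R * (delta * D%:R) * ln n%:R :> R by ring.
rewrite -(mulrA C) ler_wpM2r ?(le_trans (ltW ln2)) // ler_wpM2r //.
by rewrite lerDr.
Qed.
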